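(* Let $k\geq l\geq 1$ and let $T_{k,l}$ be the set of families of positive integers $T=(a_i,b_i)_{1\leq i\leq k-l}$ such that $a_i>b_i$ and $a_i\leq l+i$ for all $i$, and $a_i\geq b_{i+1}$ for $1\leq i<k-l$ (these are the row-strict plane partitions of skew shape $(k-l+1,k-l,\ldots,2)/(k-l-1,k-l-2,\ldots,0)$, row $i$ having entries $a_i,b_i$ from left to right, with largest entry in row $i$ at most $l+i$). Put $|T|=\sum_{i=1}^{k-l}(a_i+b_i)$. Then $$c_{k,l}(q)=\sum_{T\in T_{k,l}}q^{k^2-l^2-|T|}.$$
   Context: For $m\in\mathbb Z$, $r\in\mathbb N$: $(x;q)_r=(1-x)(1-xq)\cdots(1-xq^{r-1})$, ${m\brack r}_q=\frac{(q^{m-r+1};q)_r}{(q;q)_r}$, and entries with negative lower index are $0$. Let $G_q=\left({i\brack 2i-2j}_q\,q^{(i-j-1)(i-j)}\right)_{i,j\geq 1}$ (lower unitriangular) and $G_q^{-1}=((-1)^{i-j}c_{i,j}(q))_{i,j\geq 1}$. A row-strict plane partition of a skew shape is a filling of its cells by positive integers strictly decreasing from left to right along rows and weakly decreasing from top to bottom along (geometric) columns; in the shape above, the left cell of row $i$ and the right cell of row $i+1$ lie in the same column. *)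

(* Defs.v *)
From HB Require Import structures.
From mathcomp Require Import all_boot all_order all_algebra.
From mathcomp Require Import zify.

Set Implicit Arguments.
Unset Strict Implicit.
Unset Printing Implicit Defensive.

Import Order.TTheory GRing.Theory Num.Theory.
Local Open Scope ring_scope.

(* Infinite matrices (A i j)_(i, j >= 1): only the values at indices i, j >= 1
   are meaningful. *)
Section InfiniteMatrices.
Variable K : fieldType.
Implicit Types A B : nat -> nat -> K.

Definition lower_triangular A : Prop :=
  forall i j : nat, (0 < i)%N -> (i < j)%N -> A i j = 0.

Definition lower_unitriangular A : Prop :=
  lower_triangular A /\ forall i : nat, (0 < i)%N -> A i i = 1.

(* For A lower triangular, the sum over all m >= 1 stops at m = i. *)
Definition ltmul A B (i j : nat) : K := \sum_(1 <= m < i.+1) A i m * B m j.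

Definition lt_inverse A B : Prop :=
  lower_triangular B /\
  forall i j : nat, (0 < i)%N -> (0 < j)%N ->
    ltmul A B i j = (i == j)%:R /\ ltmul B A i j = (i == j)%:R.

Section InverseExists.
Variable A : nat -> nat -> K.
Hypothesis hA : lower_unitriangular A.

Fixpoint ltinv_upto (n i j : nat) : K :=
  if n is n'.+1 then
    if i == n then (i == j)%:R - \sum_(1 <= m < n) A n m * ltinv_upto n' m j
    else ltinv_upto n' i j
  else 0.

Lemma ltinv_upto_diag n i j : (i <= n)%N -> ltinv_upto n i j = ltinv_upto i i j.
Proof.
elim: n => [|n IH]; first by rewrite leqn0 => /eqP->.
by rewrite leq_eqVlt => /predU1P[->//|lt_in] /=; rewrite ltn_eqF // IH.
Qed.

Let B i j := ltinv_upto i i j.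

Lemma ltinvE i j : (0 < i)%N ->
  B i j = (i == j)%:R - \sum_(1 <= m < i) A i m * B m j.
Proof.
case: i => // i _; rewrite /B /= eqxx; congr (_ - _).
by apply: eq_big_nat => m /andP[_ ltmi]; rewrite (@ltinv_upto_diag i m j ltmi).
Qed.

Lemma ltinv_lower : lower_triangular B.
Proof.
move=> i j; elim/ltn_ind: i => i IH i_gt0 lt_ij.
rewrite ltinvE // ltn_eqF // sub0r big_nat big1 ?oppr0 // => m /andP[m_gt0 ltmi].
by rewrite IH ?mulr0 // (ltn_trans ltmi).
Qed.

Lemma ltinv_right i j : (0 < i)%N -> ltmul A B i j = (i == j)%:R.
Proof.
by move=> i_gt0; rewrite /ltmul big_nat_recr //= hA.2 // mul1r ltinvE // addrC subrK.
Qed.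

Lemma ltmul_section C D (hC : lower_triangular C) n (i j : 'I_n) :
  (\matrix_(i < n, j < n) C i.+1 j.+1 *m \matrix_(i < n, j < n) D i.+1 j.+1) i j
  = ltmul C D i.+1 j.+1.
Proof.
rewrite mxE /ltmul big_add1 /=.
under eq_bigr do rewrite !mxE.
rewrite -(big_mkord xpredT (fun m => C i.+1 m.+1 * D m.+1 j.+1)).
rewrite (big_cat_nat (n := i.+1)) //= [X in _ + X]big_nat.
by rewrite [X in _ + X]big1 ?addr0 // => m /andP[ltim _]; rewrite hC ?mul0r.
Qed.

Lemma lt_inverse_exists : exists B, lt_inverse A B.
Proof.
exists B; split=> [|i j i_gt0 j_gt0]; first exact: ltinv_lower.
split; first exact: ltinv_right.
case: i j i_gt0 j_gt0 => [//|i] [//|j] _ _; pose n := (maxn i j).+1.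
have lein : (i < n)%N by rewrite ltnS leq_maxl.
have lejn : (j < n)%N by rewrite ltnS leq_maxr.
have AB1 : \matrix_(i < n, j < n) A i.+1 j.+1 *m \matrix_(i < n, j < n) B i.+1 j.+1
           = 1%:M.
  by apply/matrixP=> u v; rewrite (ltmul_section _ hA.1) ltinv_right // !mxE eqSS.
have /matrixP/(_ (Ordinal lein) (Ordinal lejn)) := mulmx1C AB1.
by rewrite (ltmul_section _ ltinv_lower) !mxE -val_eqE /= eqSS.
Qed.

End InverseExists.
End InfiniteMatrices.

Section QBinomials.
Variables (K : fieldType) (q : K).

Definition qpoch (x : K) (r : nat) : K := \prod_(s < r) (1 - x * q ^+ s).

Definition qbinom (m r : int) : K :=
  match r with
  | Posz r' => qpoch (q ^ (m - r'%:Z + 1)) r' / qpoch q r'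
  | Negz _ => 0
  end.

Definition Gq (i j : nat) : K :=
  qbinom i%:Z (2 * i%:Z - 2 * j%:Z)
  * q ^ ((i%:Z - j%:Z - 1) * (i%:Z - j%:Z)).

Lemma Gq_unitriangular : lower_unitriangular Gq.
Proof.
split=> [i j i_gt0 ltij|i i_gt0]; rewrite /Gq.
  case E: (2 * i%:Z - 2 * j%:Z) => [r|r] /=; last by rewrite mul0r.
  by exfalso; lia.
by rewrite !subrr mulr0 expr0z mulr1 /= /qpoch !big_ord0 divr1.
Qed.

End QBinomials.

(* Families (a_i, b_i)_(1 <= i <= k - l), with T i = (a_(i+1), b_(i+1)) for
   i : 'I_(k - l). *)
Definition is_rspp (k l : nat) (T : 'I_(k - l) -> nat * nat) : bool :=
  [forall i : 'I_(k - l),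
     [&& (0 < (T i).1)%N, (0 < (T i).2)%N, ((T i).2 < (T i).1)%N
       & ((T i).1 <= l + i.+1)%N]] &&
  [forall i : 'I_(k - l), forall i' : 'I_(k - l),
     (i' == i.+1 :> nat) ==> ((T i').2 <= (T i).1)%N].

Lemma is_rspp_bounded (k l : nat) (T : 'I_(k - l) -> nat * nat) :
  is_rspp T -> forall i, ((T i).1 < k.+1)%N && ((T i).2 < k.+1)%N.
Proof.
move=> /andP[/forallP hT _] i; have /and4P[_ _ h1 h2] := hT i.
by have := ltn_ord i; lia.
Qed.

(* The bound k on the entries, which makes the ambient type finite, excludes no
   family, by is_rspp_bounded. *)
Definition rspp (k l : nat) : {set {ffun 'I_(k - l) -> 'I_k.+1 * 'I_k.+1}} :=
  [set T : {ffun 'I_(k - l) -> 'I_k.+1 * 'I_k.+1}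
     | is_rspp (fun i => (val (T i).1, val (T i).2))].

Definition rspp_weight (k l : nat)
    (T : {ffun 'I_(k - l) -> 'I_k.+1 * 'I_k.+1}) : nat :=
  (\sum_(i < k - l) ((T i).1 + (T i).2))%N.

Definition Qq : fieldType := {fraction {poly rat}}.
Definition qvar : Qq := tofrac ('X : {poly rat}).

(* Main.v *)
(* Put y = 1/q and let f_n be the sum of y^|T| over the families T with n rows.
   Apply inclusion-exclusion to the conditions a_i >= b_(i+1), from the last one
   backwards: the rows after the j-th one then form a strictly
   increasing chain b_(j+1) < a_(j+1) < ... < a_n <= l + n, counted by the
   elementary symmetric polynomial e_(2(n-j))(y, ..., y^(l+n)); the other
   bounds a_i <= l + i follow from the strict increase. Hence
   sum_(j <= n) (-1)^(n-j) f_j e_(2(n-j))(y, ..., y^(l+n)) = 0 for n > 0.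
   Up to the factor q^(i^2 - m^2) the entry (i, m) of G_q is
   e_(2(i-m))(y, ..., y^i), so this recurrence says that the proposed matrix is
   a right inverse of G_q. *)
Require Import Defs.
From HB Require Import structures.
From mathcomp Require Import all_boot all_order all_algebra.
From mathcomp Require Import zify ring.

Set Implicit Arguments.
Unset Strict Implicit.
Unset Printing Implicit Defensive.

Import Order.TTheory GRing.Theory Num.Theory.
Local Open Scope ring_scope.

(** * Families extended by a last row *)

Section FfunRcons.
Variables (V : nmodType) (T : finType) (n : nat).

Definition ffun_rcons (g : {ffun 'I_n -> T}) (p : T) : {ffun 'I_n.+1 -> T} :=
  [ffun i => if unlift ord_max i is Some j then g j else p].

Lemma ffun_rcons_lift g p j : ffun_rcons g p (lift ord_max j) = g j.
Proof. by rewrite ffunE liftK. Qed.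

Lemma ffun_rcons_max g p : ffun_rcons g p ord_max = p.
Proof. by rewrite ffunE unlift_none. Qed.

Lemma sum_ffun_rcons (P : pred {ffun 'I_n.+1 -> T})
    (F : {ffun 'I_n.+1 -> T} -> V) :
  \sum_(f | P f) F f =
  \sum_(g : {ffun 'I_n -> T}) \sum_(p | P (ffun_rcons g p)) F (ffun_rcons g p).
Proof.
rewrite pair_big_dep /=.
apply: (reindex (fun gp : {ffun 'I_n -> T} * T => ffun_rcons gp.1 gp.2)).
exists (fun f : {ffun 'I_n.+1 -> T} =>
          ([ffun j => f (lift ord_max j)], f ord_max)) => [[g p]|f] _ /=.
  rewrite ffun_rcons_max; congr pair.
  by apply/ffunP => j; rewrite ffunE ffun_rcons_lift.
apply/ffunP => i; case: (unliftP ord_max i) => [j|] ->.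
  by rewrite ffun_rcons_lift ffunE.
by rewrite ffun_rcons_max.
Qed.

End FfunRcons.

Lemma sum_nat_ord (V : nmodType) N m n (P : pred nat) (F : nat -> V) :
  (n <= N)%N ->
  \sum_(m <= i < n | P i) F i =
  \sum_(i < N | [&& (m <= i)%N, (i < n)%N & P i]) F i.
Proof.
move=> le_nN.
rewrite big_geq_mkord (big_ord_widen_cond N (fun i => P i && (m <= i)%N) F) //.
by apply: eq_bigl => i; rewrite andbC andbA andbC.
Qed.

(** * The generating function in y = 1/q and its recurrence *)

Section GeneratingFunction.
Variables (K : fieldType) (y : K) (l : nat).

(** The number of rows is a free [n] instead of [k - l], so that induction on it can keep [l] fixed;
    at [n := k - l] this is convertible to [is_rspp]. *)
Definition legal n (T : 'I_n -> nat * nat) : bool :=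
  [forall i : 'I_n,
     [&& (0 < (T i).1)%N, (0 < (T i).2)%N, ((T i).2 < (T i).1)%N
       & ((T i).1 <= l + i.+1)%N]] &&
  [forall i : 'I_n, forall i' : 'I_n,
     (i' == i.+1 :> nat) ==> ((T i').2 <= (T i).1)%N].

Definition last_ge n (T : 'I_n -> nat * nat) (c : nat) : bool :=
  [forall i : 'I_n, (i.+1 == n) ==> (c <= (T i).1)%N].

Definition entries n N (T : {ffun 'I_n -> 'I_N * 'I_N}) (i : 'I_n) : nat * nat :=
  (val (T i).1, val (T i).2).

Lemma last_ge_rcons n N (g : {ffun 'I_n -> 'I_N * 'I_N}) p c :
  last_ge (entries (ffun_rcons g p)) c = (c <= p.1)%N.
Proof.
apply/forallP/idP => [/(_ ord_max)|le_cp i].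
  by rewrite eqxx /entries ffun_rcons_max.
apply/implyP => /eqP[]/= ein.
suff -> : i = ord_max by rewrite /entries ffun_rcons_max.
exact: val_inj.
Qed.

Lemma legal_rcons n N (g : {ffun 'I_n -> 'I_N * 'I_N}) p :
  legal (entries (ffun_rcons g p)) =
  [&& legal (entries g), last_ge (entries g) p.2
    & [&& 0 < p.1, 0 < p.2, p.2 < p.1 & p.1 <= l + n.+1]%N].
Proof.
have entL j : entries (ffun_rcons g p) (lift ord_max j) = entries g j.
  by rewrite /entries ffun_rcons_lift.
have entM : entries (ffun_rcons g p) ord_max = (val p.1, val p.2).
  by rewrite /entries ffun_rcons_max.
apply/andP/and3P => [[/forallP rows /forallP cols]|].
  split; last by have := rows ord_max; rewrite entM.
    apply/andP; split; apply/forallP => i.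
      by have := rows (lift ord_max i); rewrite entL lift_max.
    apply/forallP => i'.
    have /forallP/(_ (lift ord_max i')) := cols (lift ord_max i).
    by rewrite !entL !lift_max.
  apply/forallP => i; have /forallP/(_ ord_max) := cols (lift ord_max i).
  by rewrite entL entM lift_max /= eq_sym.
move=> [/andP[/forallP rows /forallP cols] /forallP lastg rown].
split; apply/forallP => i.
  case: (unliftP ord_max i) => [j|] ->; last by rewrite entM.
  by rewrite entL lift_max; apply: rows.
apply/forallP => i'.
case: (unliftP ord_max i) => [j|] ->; case: (unliftP ord_max i') => [j'|] ->.
- by rewrite !entL !lift_max; have /forallP := cols j; apply.
- by rewrite entL entM lift_max /= eq_sym; apply: lastg.
- rewrite lift_max /=; apply/implyP => /eqP e.
  by have := ltn_ord j'; rewrite e ltnNge leqnSn.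
- by rewrite /= eqn_leq ltnn andbF.
Qed.

(* Only families whose last row has left entry at least c are counted. *)
Fixpoint rspp_gf (n c : nat) : K :=
  if n is n'.+1 then
    \sum_(1 <= a < (l + n).+1 | (c <= a)%N)
      y ^+ a * \sum_(1 <= b < a) y ^+ b * rspp_gf n' b
  else 1.

(** Removing the last row (a, b) leaves a family whose own last left entry is at least b, so the
    induction must run over all [c]. The bound on [N] keeps the finite type from excluding any
    row. *)
Lemma rspp_gfE n N c : (l + n < N)%N ->
  \sum_(T : {ffun 'I_n -> 'I_N * 'I_N} |
          legal (entries T) && last_ge (entries T) c)
     y ^+ (\sum_(i < n) ((T i).1 + (T i).2))%N = rspp_gf n c.
Proof.
elim: n c => [|n IH] c ltN.
  rewrite (eq_bigr (fun=> 1)) => [|T _]; last by rewrite big_ord0.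
  rewrite (eq_bigl predT); last first.
    move=> T /=; rewrite /legal /last_ge.
    by apply/andP; split; [apply/andP; split|]; apply/forallP => -[].
  by rewrite sumr_const card_ffun card_ord expn0.
rewrite sum_ffun_rcons.
under eq_bigr => g _.
  under eq_bigl => p do rewrite legal_rcons last_ge_rcons.
  under eq_bigr => p _.
    rewrite big_ord_recr /= ffun_rcons_max.
    under eq_bigr => i _.
      have -> : widen_ord (leqnSn n) i = lift ord_max i.
        exact/val_inj/esym/lift_max.
      rewrite ffun_rcons_lift.
      over.
    over.
  over.
(* The predicate keeps the conditions on the last row that do not involve [g]. *)
rewrite (exchange_big_dep (fun p : 'I_N * 'I_N =>
  [&& p.1 < (l + n.+1).+1, 0 < p.1, c <= p.1, 0 < p.2 & p.2 < p.1]%N)) /=;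
  last by move=> g p _; lia.
transitivity (\sum_(a < N | [&& a < (l + n.+1).+1, 0 < a & c <= a]%N)
   \sum_(b < N | (0 < b)%N && (b < a)%N) y ^+ a * (y ^+ b * rspp_gf n b)).
  rewrite [RHS]pair_big_dep /=; apply: eq_big => [p|p cond]; first by lia.
  rewrite -IH ?mulr_sumr; last by lia.
  apply: eq_big => [g|g _].
    by move: cond; case: (legal _) => //=; case: (last_ge _ _) => //=; lia.
  by rewrite !exprD; ring.
rewrite (@sum_nat_ord _ N); last by lia.
apply: eq_big => [a|a _]; first by lia.
rewrite -mulr_sumr; congr (_ * _).
rewrite (@sum_nat_ord _ N); last exact: ltnW.
by apply: eq_bigl => b; rewrite andbT.
Qed.

(** By the bound on [c], every [a < c] already satisfies the row bound, so the subtracted terms all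
    occur in [rspp_gf n.+1 0]. *)
Lemma rspp_gf_split n c : (0 < c <= (l + n.+1).+1)%N ->
  rspp_gf n.+1 c = rspp_gf n.+1 0 -
    \sum_(1 <= a < c) y ^+ a * \sum_(1 <= b < a) y ^+ b * rspp_gf n b.
Proof.
move=> /andP[c_gt0 le_c] /=.
rewrite [X in _ = X - _](big_cat_nat (n := c)) //= [RHS]addrC addKr.
rewrite (big_cat_nat (n := c)) //=.
rewrite [X in X + _]big_nat_cond big_pred0 ?add0r; last by move=> a; lia.
by rewrite big_nat_cond [RHS]big_nat_cond; apply: eq_bigl => a; lia.
Qed.

(* e_r(y, y^2, ..., y^N), expanded along the largest index a of a factor y^a. *)
Fixpoint elem (r N : nat) : K :=
  if r is r'.+1 then \sum_(1 <= a < N.+1) y ^+ a * elem r' a.-1 else 1.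

(* Inclusion-exclusion on the last condition: [a_n >= c] holds unless [a_n < c],
   and in the latter case the last row extends the increasing chain. *)
Lemma rspp_gf_expansion n c : (0 < c <= (l + n).+1)%N ->
  rspp_gf n c =
  \sum_(j < n.+1) (-1) ^+ (n - j) * rspp_gf j 0 * elem (n - j).*2 c.-1.
Proof.
elim: n c => [|n IH] c le_c; first by rewrite big_ord1 /= !mulr1.
rewrite rspp_gf_split // big_ord_recr /= subnn /= !mul1r mulr1 addrC.
congr (_ + _).
(* The sum over b raises the degree of [elem] from [(n - j).*2] to [(n - j).*2.+1]; the sum over a
   then raises it once more. *)
rewrite (eq_big_nat _ _ (F2 := fun a => \sum_(j < n.+1)
   (-1) ^+ (n - j) * rspp_gf j 0 * (y ^+ a * elem (n - j).*2.+1 a.-1))); last first.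
  move=> a ha; rewrite (eq_big_nat _ _ (F2 := fun b => \sum_(j < n.+1)
     (-1) ^+ (n - j) * rspp_gf j 0 * (y ^+ b * elem (n - j).*2 b.-1))); last first.
    move=> b hb; rewrite IH; last by lia.
    by rewrite mulr_sumr; apply: eq_bigr => j _; ring.
  rewrite exchange_big /= mulr_sumr; apply: eq_bigr => j _.
  by rewrite -mulr_sumr prednK; [ring | lia].
rewrite exchange_big /= -sumrN; apply: eq_bigr => j _.
rewrite -mulr_sumr subSn; last by rewrite -ltnS.
by rewrite doubleS /= exprS prednK; [ring | lia].
Qed.

(* For n > 0 the left-hand side is rspp_gf n (l + n).+1, an empty sum. *)
Lemma rspp_gf_rec n :
  \sum_(j < n.+1) (-1) ^+ (n - j) * rspp_gf j 0 * elem (n - j).*2 (l + n) =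
  (n == 0%N)%:R.
Proof.
rewrite -(@rspp_gf_expansion n (l + n).+1) ?leqnn //.
case: n => [//|n] /=.
by rewrite big_nat_cond big_pred0 // => a; lia.
Qed.

End GeneratingFunction.

(** * q-binomials as elementary symmetric polynomials; a right inverse of [Gq] *)

Section QBinomial.
Variables (K : fieldType) (q : K).
Hypothesis q_neq0 : q != 0.
Hypothesis q_nroot : forall n, (0 < n)%N -> q ^+ n != 1.

Lemma qpoch_recl x r : qpoch q x r.+1 = (1 - x) * qpoch q (x * q) r.
Proof.
rewrite /qpoch big_ord_recl mulr1; congr (_ * _).
by apply: eq_bigr => i _; rewrite /= exprS mulrA.
Qed.

Lemma qpoch_recr x r : qpoch q x r.+1 = qpoch q x r * (1 - x * q ^+ r).
Proof. by rewrite /qpoch big_ord_recr. Qed.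

Lemma qpoch_neq0 r : qpoch q q r != 0.
Proof.
apply/prodf_neq0 => i _.
by rewrite -exprS subr_eq0 eq_sym q_nroot.
Qed.

Lemma qbinom_pascal (N r : nat) :
  qbinom q N.+1 r.+1 = q ^+ r.+1 * qbinom q N r.+1 + qbinom q N r.
Proof.
rewrite /qbinom.
have -> : N.+1%:Z - r.+1%:Z + 1 = (N%:Z - r%:Z) + 1 by lia.
have -> : N%:Z - r.+1%:Z + 1 = N%:Z - r%:Z by lia.
rewrite expfzDr // expr1z; set z := q ^ (N%:Z - r%:Z).
(* All three numerators share the factor [qpoch q (z * q) r]. *)
rewrite (qpoch_recl z) !qpoch_recr -mulrA -exprS.
have := qpoch_neq0 r; have := q_nroot (ltn0Sn r).
rewrite eq_sym -subr_eq0 exprS => h1 h2.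
by field; rewrite h2 h1.
Qed.

Lemma qbinom0 (r : nat) : qbinom q 0 r = (r == 0%N)%:R.
Proof.
case: r => [|r]; first by rewrite /qbinom /qpoch !big_ord0 divr1.
(* The last factor of the numerator is [1 - q^(-r) * q^r = 0]. *)
rewrite /qbinom qpoch_recr.
have -> : 0 - r.+1%:Z + 1 = - r%:Z by lia.
by rewrite -exprnN mulVf ?expf_neq0 // subrr mulr0 mul0r.
Qed.

(** The factor [q ^+ (r * N)] turns each y^a into q^(N-a), giving the classical value of e_r(1, q,
    ..., q^(N-1)). Splitting off the largest index matches the q-Pascal rule. *)
Lemma elem_qbinom (r N : nat) :
  elem q^-1 r N * q ^+ (r * N) = q ^+ 'C(r, 2) * qbinom q N r.
Proof.
elim: N r => [|N IH] [|r].
- by rewrite qbinom0 mul0n !mulr1.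
- by rewrite qbinom0 /= big_geq // mul0r mulr0.
- by rewrite mul0n /qbinom /qpoch !big_ord0 divr1 !mulr1.
have binE : q ^+ 'C(r.+1, 2) * qbinom q N r =
            q ^+ r * (q ^+ 'C(r, 2) * qbinom q N r).
  by rewrite binS bin1 addnC exprD mulrA.
rewrite qbinom_pascal mulrDr mulrCA -IH binE -IH /= big_nat_recr //= mulrDl.
rewrite mulnS exprD; congr (_ + _); first by rewrite mulrCA.
rewrite mulSn exprD exprVn !exprS; field.
by rewrite q_neq0 expf_neq0.
Qed.

(** With d = i - j, the exponents agree because d(d-1) + 2di = i^2 - j^2 + d(2d-1). *)
Lemma Gq_elem (i j : nat) : (j <= i)%N ->
  Gq q i j = q ^ (i%:Z ^+ 2 - j%:Z ^+ 2) * elem q^-1 (i - j).*2 i.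
Proof.
move=> le_ji; rewrite /Gq.
have -> : 2 * i%:Z - 2 * j%:Z = (i - j).*2%:Z by lia.
have qn : q ^+ ((i - j).*2 * i) != 0 by rewrite expf_neq0.
apply: (mulIf qn).
rewrite -[RHS]mulrA elem_qbinom -[LHS]mulrA [LHS]mulrC [RHS]mulrA.
congr (_ * _).
have -> : 'C((i - j).*2, 2) = ((i - j) * (i - j).*2.-1)%N.
  by rewrite bin2 -muln2 mulnAC muln2 doubleK.
rewrite !exprnP -!expfzDr //; congr (q ^ _).
have -> : ((i - j) * (i - j).*2.-1)%N%:Z =
          (i%:Z - j%:Z) * (2 * (i%:Z - j%:Z) - 1).
  (* At i = j the truncated predecessor is 0 rather than -1, but its cofactor is 0. *)
  rewrite PoszM -subzn //; case: (ltnP j i) => [lt_ji|le_ij].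
    by congr (_ * _); lia.
  by have -> : i = j by [lia]; rewrite subrr !mul0r.
have -> : ((i - j).*2 * i)%N%:Z = 2 * (i%:Z - j%:Z) * i%:Z.
  by rewrite PoszM; congr (_ * _); lia.
by ring.
Qed.

Definition rspp_inv (i j : nat) : K :=
  if (j <= i)%N then
    (-1) ^+ (i - j) * (q ^ (i%:Z ^+ 2 - j%:Z ^+ 2) * rspp_gf q^-1 j (i - j) 0)
  else 0.

(** The powers q^(i^2-m^2) and q^(m^2-j^2) multiply to a factor independent of m; with m = j + t,
    what remains is [rspp_gf_rec] for [l := j] and [n := i - j]. *)
Lemma ltmul_Gq_rspp_inv i j : (0 < j)%N ->
  ltmul (Gq q) rspp_inv i j = (i == j)%:R.
Proof.
move=> j_gt0; rewrite /ltmul.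
have [le_ji|lt_ij] := leqP j i; last first.
  rewrite ltn_eqF // big_nat big1 // => m /andP[_ lt_mi].
  by rewrite /rspp_inv ifF ?mulr0 //; lia.
rewrite (big_cat_nat (n := j)) //=; last exact: leqW.
rewrite [X in X + _]big_nat big1 ?add0r => [|m /andP[_ lt_mj]]; last first.
  by rewrite /rspp_inv leqNgt lt_mj mulr0.
have -> : (i == j) = (i - j == 0)%N by lia.
have := rspp_gf_rec q^-1 j (i - j); rewrite subnKC // => rec.
transitivity ((-1) ^+ (i - j) * q ^ (i%:Z ^+ 2 - j%:Z ^+ 2)
              * (i - j == 0)%N%:R : K); last first.
  case: eqP => [ij0|]; last by rewrite mulr0.
  have -> : i = j by lia.
  by rewrite subnn subrr !mul1r.
rewrite -rec mulr_sumr -[j in LHS]add0n big_addn big_mkord subSn //.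
apply: eq_bigr => t _; have le_tn : (t <= i - j)%N by rewrite -ltnS.
rewrite add0n /rspp_inv leq_addl addnK Gq_elem; last by lia.
have -> : (i - (t + j))%N = (i - j - t)%N by lia.
have -> : q ^ (i%:Z ^+ 2 - j%:Z ^+ 2) =
  q ^ (i%:Z ^+ 2 - (t + j)%N%:Z ^+ 2) * q ^ ((t + j)%N%:Z ^+ 2 - j%:Z ^+ 2).
  by rewrite -expfzDr //; congr (q ^ _); ring.
rewrite -[in (-1) ^+ (i - j)](subnK le_tn) exprD.
have sgn : (-1) ^+ (i - j - t) * (-1) ^+ (i - j - t) = 1 :> K.
  by rewrite -expr2 sqrr_sign.
rewrite -[LHS]mul1r -[X in X * _ = _]sgn; ring.
Qed.

End QBinomial.

(** * Uniqueness of the right inverse by forward substitution, and the conclusion *)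

Lemma ltmul_inj (K : fieldType) (A B C : nat -> nat -> K) j :
  lower_unitriangular A ->
  (forall i, (0 < i)%N -> ltmul A B i j = ltmul A C i j) ->
  forall i, (0 < i)%N -> B i j = C i j.
Proof.
move=> [_ A1] eqBC; elim/ltn_ind => i IH i_gt0.
have := eqBC i i_gt0; rewrite /ltmul !big_nat_recr //= A1 // !mul1r.
rewrite (eq_big_nat _ _ (F2 := fun m => A i m * C m j)); first exact: addrI.
by move=> m /andP[m_gt0 lt_mi]; rewrite IH.
Qed.

Lemma qvar_neq0 : qvar != 0.
Proof. by rewrite tofrac_eq0 polyX_eq0. Qed.

Lemma qvar_nroot n : (0 < n)%N -> qvar ^+ n != 1.
Proof.
move=> n_gt0; rewrite -tofracXn -tofrac1 tofrac_eq.
apply/eqP => /(congr1 (fun p : {poly rat} => size p)).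
by rewrite size_polyXn size_poly1; lia.
Qed.

Theorem theorem7 (c : nat -> nat -> Qq)
    (hc : lt_inverse (Gq qvar) (fun i j => (-1) ^ (i%:Z - j%:Z) * c i j))
    (k l : nat) (hl : (1 <= l)%N) (hkl : (l <= k)%N) :
  c k l = \sum_(T in rspp k l)
            qvar ^ ((k ^ 2)%N%:Z - (l ^ 2)%N%:Z - (rspp_weight T)%:Z).
Proof.
have q0 := qvar_neq0.
have k_gt0 : (0 < k)%N by apply: leq_trans hkl.
have := @ltmul_inj _ _ _ (rspp_inv qvar) l (Gq_unitriangular qvar) _ k k_gt0.
move=> /(_ (fun i j => (-1) ^ (i%:Z - j%:Z) * c i j)) ckl.
have {}ckl := ckl (fun i i_gt0 => etrans (hc.2 i l i_gt0 hl).1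
  (esym (ltmul_Gq_rspp_inv q0 qvar_nroot i hl))).
move: ckl; rewrite /rspp_inv hkl subzn // -exprnP.
move=> /(mulfI (negbT (signr_eq0 _ _)))->.
(* The largest row bound is l + (k - l) = k, and [c = 0] makes [last_ge] vacuous. *)
rewrite -(@rspp_gfE _ _ _ _ k.+1); last by rewrite subnKC.
rewrite mulr_sumr; apply: eq_big => [T|T _].
  rewrite inE /last_ge; case: (boolP (is_rspp _)) => [legT|/negbTE].
    by apply/andP; split=> //; apply/forallP => i; rewrite implybT.
  by rewrite -[is_rspp _]/(legal _ _) => ->.
by rewrite (exprVn qvar) (exprnN qvar) -expfzDr.
Qed.
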